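(* Every nontrivially unstable circulant graph $\operatorname{Cay}(\mathbb{Z}_n,S)$ of valency at most $4$ has Wilson type (C.4), i.e., $n$ is even and there exists $m\in\mathbb{Z}_n^\times$ with $(n/2)+mS=S$.
   Context: All graphs are finite, undirected and simple. For $S\subseteq\mathbb{Z}_n\setminus\{0\}$ with $S=-S$, $\operatorname{Cay}(\mathbb{Z}_n,S)$ has vertex set $\mathbb{Z}_n$, with $v\sim w$ iff $w-v\in S$. The canonical bipartite double cover $BX$ of $X$ has vertex set $V(X)\times\{0,1\}$, with $(v,0)\sim(w,1)$ iff $v\sim w$ in $X$. $X$ is unstable if $\operatorname{Aut}BX\neq\operatorname{Aut}X\times S_2$. A graph is twin-free if no two distinct vertices have the same neighbourhood. $X$ is nontrivially unstable if it is connected, nonbipartite, twin-free and unstable. *)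

(* Defs.v *)
From HB Require Import structures.
From mathcomp Require Import all_boot all_order all_algebra all_fingroup.

Set Implicit Arguments.
Unset Strict Implicit.
Unset Printing Implicit Defensive.

Import GRing.Theory.
Local Open Scope ring_scope.

(* A finite simple graph is an irreflexive symmetric relation [e : rel T] on
   a finite type.  For [cayley S] these two properties amount to
   [0 \notin S] and [-S = S]. *)

Definition cayley n (S : {set 'Z_n}) : rel 'Z_n := fun v w => w - v \in S.

Section Graph.
Variables (T : finType) (e : rel T).

Definition nbhd (v : T) : {set T} := [set w | e v w].

Definition has_valency (d : nat) : Prop := forall v, #|nbhd v| = d.

Definition connected_graph : Prop := forall v w, connect e v w.

Definition bipartite : Prop :=
  exists c : T -> bool, forall v w, e v w -> c v != c w.

Definition twin_free : Prop := forall v w, nbhd v = nbhd w -> v = w.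

Definition graph_aut : {set {perm T}} :=
  [set f : {perm T} | [forall v, forall w, e (f v) (f w) == e v w]].

(* The layers 0 and 1 are [false] and [true]. *)
Definition double_cover : rel (T * bool) :=
  fun x y => (x.2 != y.2) && e x.1 y.1.

End Graph.

Section ProdPerm.
Variables (A B : finType) (f : {perm A}) (g : {perm B}).

Lemma prod_perm_inj : injective (fun x : A * B => (f x.1, g x.2)).
Proof. by move=> [a b] [c d] /= [] /perm_inj -> /perm_inj ->. Qed.

Definition prod_perm : {perm A * B} := perm prod_perm_inj.

End ProdPerm.

(* [Aut X x S_2], as the subgroup of [Aut BX] in which [S_2] permutes the two
   layers. *)
Definition expected_aut (T : finType) (e : rel T) : {set {perm T * bool}} :=
  [set prod_perm f s | f in graph_aut e, s in [set: {perm bool}]].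

Definition unstable (T : finType) (e : rel T) : Prop :=
  graph_aut (double_cover e) <> expected_aut e.

Definition nontrivially_unstable (T : finType) (e : rel T) : Prop :=
  [/\ connected_graph e, ~ bipartite e, twin_free e & unstable e].

Definition wilson_C4 n (S : {set 'Z_n}) : Prop :=
  ~~ odd n /\
  exists2 m : 'Z_n, m \is a GRing.unit &
    [set (n./2)%:R + m * s | s in S] = S.

(* ['Z_n] is the ring of integers mod [n] only for [1 < n].  Nothing is lost by
   excluding [n = 1]: a one-vertex graph is bipartite. *)
Lemma one_vertex_not_nontrivially_unstable (T : finType) (e : rel T) :
  irreflexive e -> #|T| = 1%N -> ~ nontrivially_unstable e.
Proof.
move=> e_irr /fintype1 [x Tx] [_ nbip _ _]; apply: nbip.
by exists (fun=> false) => v w; rewrite (Tx v) (Tx w) e_irr.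
Qed.

(* Main.v *)
Require Import Defs.
From mathcomp Require Import all_boot all_order all_algebra all_fingroup.
From mathcomp Require Import ring.

Set Implicit Arguments.
Unset Strict Implicit.
Unset Printing Implicit Defensive.

Import GRing.Theory.
Local Open Scope ring_scope.

(* Since X is connected and nonbipartite, BX is connected, and instability gives
   a layer-preserving automorphism of BX that fixes (0,0) and moves (0,1) to some
   (t,1) with t <> 0.  Write S = {a, -a} or S = {a, -a, b, -b} (with 2b = 0 in the
   cubic case).  Unless two differences of elements of S coincide accidentally,
   counting common neighbours shows that the automorphism sends opposite edges at
   a vertex to opposite edges and completes 4-cycles as the group does; hence it
   is a group automorphism of Z_n x Z_2, which forces 2t = 0 and gives type (C.4)
   with t = n/2.  The accidental cases are: 2a = 2b or 2a = -2b, where X has twins;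
   4a = 0 and b = 2a, where X is K_4; and b = 3a up to signs and exchange of a and
   b.  In the last case n is odd because X is not bipartite, and either X is K_5,
   or the pairs at distance 2a are those with three common neighbours, so that
   the automorphism acts as x or -x on one layer; both contradict t <> 0. *)

(** * Connectivity of the double cover *)

Lemma connect_closed (T : finType) (e : rel T) (P : T -> Prop) x y :
  (forall u v, e u v -> P u -> P v) -> connect e x y -> P x -> P y.
Proof.
move=> Pe /connectP [p]; elim: p x => [|z p IHp] x /= => [_ -> //|].
by case/andP=> exz ep Ey Px; apply: (IHp z) => //; apply: Pe Px.
Qed.

(** Walks of X lift to BX, so it suffices to join the two lifts of one vertex. If that failed
    everywhere, the component of [(v, false)] would contain exactly one lift of each vertex and so
    2-colour X. *)
Lemma double_cover_connected (T : finType) (e : rel T) :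
  symmetric e -> connected_graph e -> ~ bipartite e ->
  connected_graph (double_cover e).
Proof.
move=> e_sym e_conn nbip.
pose R := connect (double_cover e).
have R_sym : connect_sym (double_cover e).
  apply: sym_connect_sym => -[u i] [v j].
  by rewrite /double_cover /= e_sym eq_sym.
have edgeR u v i : e u v -> R (u, i) (v, ~~ i).
  by move=> euv; apply: connect1; rewrite /double_cover /= euv; case: i.
have lift u v : exists i, forall j, R (u, j) (v, i (+) j).
  apply: (@connect_closed T e (fun v => exists i, forall j, R (u, j) (v, i (+) j))
            u v _ (e_conn u v)); last by exists false => j; apply: connect0.
  move=> v1 v2 e12 [i Ri]; exists (~~ i) => j.
  by apply: (connect_trans (Ri j)); rewrite addNb; apply: edgeR.
have layers v : R (v, false) (v, true).
  case: (boolP [exists w, R (w, false) (w, true)]) => [/existsP [w Rw]|].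
    have [i Ri] := lift v w.
    apply: connect_trans (Ri false) _; rewrite R_sym.
    apply: connect_trans (Ri true) _.
    by case: i {Ri}; rewrite //= R_sym.
  rewrite negb_exists => /forallP nR; case: nbip.
  exists (fun w => R (v, false) (w, false)) => u w euw.
  apply/negP=> /eqP Euw.
  case Ru: (R (v, false) (u, false)).
    case/negP: (nR w); apply: connect_trans (connect_trans Ru (edgeR _ _ false euw)).
    by rewrite R_sym -/R -Euw Ru.
  have [i Ri] := lift v u; move: (Ri false); case: i {Ri} => /= Rvu; last by rewrite Rvu in Ru.
  by move: (connect_trans Rvu (edgeR _ _ true euw)); rewrite /= -/R -Euw Ru.
move=> [u i] [v j]; have [k Rk] := lift u v.
apply: connect_trans (Rk i) _.
by case: (k (+) i); case: j; rewrite ?connect0 // R_sym.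
Qed.

Lemma cayley_connected_ind n (S : {set 'Z_n}) (P : 'Z_n -> Prop) :
  connected_graph (cayley S) -> P 0 ->
  (forall x s, s \in S -> P x -> P (x + s)) -> forall x, P x.
Proof.
move=> conn P0 PS x; apply: connect_closed (conn 0 x) P0 => u v uv Pu.
by rewrite -(subrK u v) addrC; apply: PS.
Qed.

Lemma cayley_cover_connected_ind n (S : {set 'Z_n}) (P : bool -> 'Z_n -> Prop) :
  connected_graph (double_cover (cayley S)) -> P false 0 ->
  (forall i x s, s \in S -> P i x -> P (~~ i) (x + s)) -> forall i x, P i x.
Proof.
move=> conn P0 PS i x.
apply: (@connect_closed _ _ (fun u => P u.2 u.1) _ _ _ (conn (0, false) (x, i)) P0).
move=> [u k] [v l] /andP [/= kl uv] Pu.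
have -> : l = ~~ k by case: k l kl {Pu} => [] [].
by rewrite -(subrK u v) addrC; apply: PS.
Qed.

(** * From instability to a layer-preserving automorphism *)

(* [F false] and [F true] are the actions, on the two layers of the canonical
   double cover, of a layer-preserving automorphism. *)
Definition twofold_aut n (S : {set 'Z_n}) (F : bool -> 'Z_n -> 'Z_n) : Prop :=
  (forall i, injective (F i)) /\
  (forall i v w, (F (~~ i) w - F i v \in S) = (w - v \in S)).

Lemma expected_aut_sub (T : finType) (e : rel T) :
  expected_aut e \subset graph_aut (double_cover e).
Proof.
apply/subsetP=> _ /imset2P [f s f_aut _ ->]; rewrite inE.
apply/forallP=> x; apply/forallP=> y; apply/eqP.
rewrite /double_cover !permE /= (inj_eq perm_inj).
by move: f_aut; rewrite inE => /forallP /(_ x.1) /forallP /(_ y.1) /eqP ->.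
Qed.

Lemma unstable_twofold n (S : {set 'Z_n}) :
  connected_graph (double_cover (cayley S)) -> unstable (cayley S) ->
  exists F, [/\ twofold_aut S F, F false 0 = 0 & F true 0 != 0].
Proof.
move=> conn unst.
have [al al_aut al_nexp] :
    exists2 al, al \in graph_aut (double_cover (cayley S)) &
                al \notin expected_aut (cayley S).
  apply/subsetPn; apply/negP=> sub; apply: unst; apply/eqP.
  by rewrite eqEsubset sub expected_aut_sub.
have {al_aut} edge x y : double_cover (cayley S) (al x) (al y) = double_cover (cayley S) x y.
  by move: al_aut; rewrite inE => /forallP /(_ x) /forallP /(_ y) /eqP.
(* [k] tells whether [al] swaps the layers; connectivity makes the answer the same at every
   vertex. *)
pose k := (al (0, false)).2.
pose F i x := (al (x, i)).1.
have alE i x : al (x, i) = (F i x, i (+) k).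
  rewrite [LHS]surjective_pairing; congr pair; move: i x.
  apply: cayley_cover_connected_ind conn _ _ => // i x s sS IH.
  have: double_cover (cayley S) (al (x, i)) (al (x + s, ~~ i)).
    by rewrite edge /double_cover /cayley /= addrC addKr sS; case: (i).
  by case/andP; rewrite IH addNb; case: (i (+) k); case: (al _).2.
have Finj i : injective (F i).
  by move=> x y Exy; have [] // : (x, i) = (y, i) by apply: (@perm_inj _ al); rewrite !alE Exy.
have Fedge i v w : (F (~~ i) w - F i v \in S) = (w - v \in S).
  have := edge (v, i) (w, ~~ i); rewrite !alE /double_cover /cayley /= addNb.
  by case: (i); case: (k).
(* Where the two layers are moved differently, translation to the origin gives the required
   automorphism. If they never are, [al] is an automorphism of X combined with a permutation of the
   layers. *)
case: (pickP (fun v => F false v != F true v)) => [v neq | eqF].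
  exists (fun i x => F i (x + v) - F false v); split.
  - split=> [i x y /addIr /Finj /addIr // | i x y].
    by rewrite opprB addrA subrK Fedge opprD addrACA subrr addr0.
  - by rewrite add0r subrr.
  - by rewrite add0r subr_eq0 eq_sym.
have {}eqF i x : F i x = F false x.
  by case: i => //; apply/esym/eqP; move: (eqF x) => /negbFE.
case/negP: al_nexp; apply/imset2P.
exists (perm (Finj false)) (perm (@addIb k)).
- rewrite inE; apply/forallP=> x; apply/forallP=> y; apply/eqP.
  by rewrite /cayley !permE -(Fedge false x y) (eqF true).
- by rewrite inE.
- by apply/permP=> -[x i]; rewrite alE permE /= !permE eqF.
Qed.

(** * Involutions and parity in ['Z_n] *)

Lemma val_Zp_add n (n_gt1 : (1 < n)%N) (x y : 'Z_n) :
  (x + y)%R = ((x + y) %% n)%N :> nat.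
Proof.
transitivity ((x + y) %% (Zp_trunc n).+2)%N => //.
by congr modn; apply: Zp_cast.
Qed.

(** Twice the representative of [x] is a multiple of [n] strictly between 0 and [2n], hence equals
    [n]. *)
Lemma Zp_involution n (n_gt1 : (1 < n)%N) (x : 'Z_n) :
  x + x = 0 -> x != 0 -> ~~ odd n /\ x = (n./2)%:R.
Proof.
move=> xx0 x0.
have x_lt : (x < n)%N by rewrite (leq_trans (ltn_ord x)) // Zp_cast.
have: ((x + x) %% n)%N = 0%N by rewrite -val_Zp_add // xx0.
have x_gt0 : (0 < x)%N by rewrite lt0n.
rewrite addnn => /eqP xn; have {xn} En : x.*2 = n.
  have [k Ek] := dvdnP xn; move: Ek; case: k => [|[|k]] //.
  - by move=> E0; rewrite -double_gt0 E0 in x_gt0.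
  - by rewrite mul1n.
  - move=> E; suff: (x.*2 < k.+2 * n)%N by rewrite E ltnn.
    by rewrite (@leq_trans n.*2) ?ltn_double // -mul2n leq_mul2r orbT.
split; first by rewrite -En odd_double.
have -> : n./2 = x by rewrite -{1}En doubleK.
by rewrite natr_Zp.
Qed.

Lemma Zp_involution_unique n (n_gt1 : (1 < n)%N) (x y : 'Z_n) :
  x + x = 0 -> y + y = 0 -> x != 0 -> y != 0 -> x = y.
Proof.
by move=> xx yy /(Zp_involution n_gt1 xx) [_ ->] /(Zp_involution n_gt1 yy) [_ ->].
Qed.

Lemma odd_Zp_add n (n_gt1 : (1 < n)%N) (x y : 'Z_n) :
  ~~ odd n -> odd (x + y)%R = odd x (+) odd y.
Proof.
move=> n_even; rewrite -oddD val_Zp_add //.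
by rewrite {2}(divn_eq (x + y) n) oddD oddM (negbTE n_even) andbF.
Qed.

(** * From preserved directions to type (C.4) *)

(* Any two neighbours [p], [q] of [0] that are not opposite span a unique
   4-cycle through [0]. *)
Definition rhombic n (S : {set 'Z_n}) : Prop :=
  forall p q z, p \in S -> q \in S -> q != p -> q != - p ->
  z - p \in S -> z - q \in S -> z = 0 \/ z = p + q.

Section TwofoldAut.
Variables (n : nat) (S : {set 'Z_n}) (F : bool -> 'Z_n -> 'Z_n).
Hypothesis S_sym : forall s, (- s \in S) = (s \in S).
Hypothesis F_aut : twofold_aut S F.

(** For [s] in [S], the direction of the image of the edge from [(v, i)] to [(v + s, ~~ i)]. *)
Definition step i v s := F (~~ i) (v + s) - F i v.

Definition straight : Prop :=
  forall i v s, s \in S -> step i v (- s) = - step i v s.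

Lemma step_mem i v s : (step i v s \in S) = (s \in S).
Proof. by rewrite /step F_aut.2 addrC addKr. Qed.

Lemma step_inj i v : injective (step i v).
Proof. by move=> s r /addIr /(F_aut.1 _) /addrI. Qed.

Lemma twofold_surj i y : exists x, F i x = y.
Proof. by have /codomP [x ->] := injF_onto (F_aut.1 i) y; exists x. Qed.

Lemma twofold_shift_notin : F false 0 = 0 -> 0 \notin S -> F true 0 \notin S.
Proof. by move=> F0; have := F_aut.2 false 0 0; rewrite /= F0 !subr0 => ->. Qed.

Lemma step_back i v s : step (~~ i) (v + s) (- s) = - step i v s.
Proof. by rewrite /step negbK addrK opprB. Qed.

(** The 4-cycle spanned at [v] by [r] and [s] has a 4-cycle as image, and [rhombic] determines the
    fourth vertex of that image, so parallel edges have parallel images. The degenerate cases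
    [r = s] and [r = - s] follow from [straight]. *)
Lemma step_invariant i v s r : straight -> rhombic S ->
  s \in S -> r \in S -> step (~~ i) (v + s) r = step i v r.
Proof.
move=> str rho sS rS.
have [-> | rNs] := eqVneq r (- s); first by rewrite step_back str.
have [-> | rs] := eqVneq r s.
  by apply: oppr_inj; rewrite -str // step_back.
have psS : step i v s \in S by rewrite step_mem.
have prS : step i v r \in S by rewrite step_mem.
have pNp : step i v r != - step i v s by rewrite -str // (inj_eq (@step_inj i v)).
have pp : step i v r != step i v s by rewrite (inj_eq (@step_inj i v)).
have E1 : F i (v + s + r) - F i v - step i v s = step (~~ i) (v + s) r.
  by rewrite /step negbK; ring.
have E2 : F i (v + s + r) - F i v - step i v r = step (~~ i) (v + r) s.
  by rewrite /step negbK (_ : v + r + s = v + s + r); ring.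
have := rho _ _ (F i (v + s + r) - F i v) psS prS pp pNp.
rewrite E1 E2 !step_mem => /(_ rS sS) [/eqP | E].
  rewrite subr_eq0 (inj_eq (F_aut.1 i)) -addrA -{2}[v]addr0 (inj_eq (addrI v)).
  by rewrite addrC addr_eq0 (negbTE rNs).
by rewrite -E1 E addrAC subrr add0r.
Qed.

Lemma affine_wilson_C4 : (1 < n)%N ->
  connected_graph (double_cover (cayley S)) -> straight -> rhombic S ->
  F false 0 = 0 -> F true 0 != 0 -> wilson_C4 S.
Proof.
move=> n_gt1 conn str rho F0; set t := F true 0 => t0.
have stepE i x s : s \in S -> step i x s = step false 0 s.
  move=> sS; move: i x; apply: cayley_cover_connected_ind conn _ _ => // i x r rS <-.
  exact: step_invariant.
have FS i x s : s \in S -> F (~~ i) (x + s) = F i x + step false 0 s.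
  by move=> sS; rewrite -(stepE i x) // /step [RHS]addrC subrK.
have FD i y j x : F (j (+) i) (x + y) = F j x + F i y.
  move: i y j x; apply: cayley_cover_connected_ind conn _ _ => [j x | i y s sS IH j x].
    by rewrite addbF F0 !addr0.
  by rewrite addbN addrA (FS (j (+) i)) // (FS i) // IH -addrA.
have tt0 : t + t = 0 by rewrite -[t + t](FD true 0 true 0) /= addr0 F0.
have [n_even tE] := Zp_involution n_gt1 tt0 t0.
split=> //; have FM x : F false x = F false 1 * x.
  rewrite -(natr_Zp x); elim: (nat_of_ord x) => [|k IH]; first by rewrite mulr0.
  by rewrite mulrSr (FD false 1 false) IH mulrDr mulr1.
(* This multiplier works because [t + F false 1 * s = F true s], and [F true] maps [S] into
   itself. *)
exists (F false 1).
  have [x Fx] := twofold_surj false 1; rewrite FM in Fx.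
  by apply/unitrPr; exists x.
rewrite -tE; apply/eqP; rewrite eqEcard card_in_imset; last first.
  move=> s r _ _ /addrI E; apply: (F_aut.1 false); by rewrite !(FM s, FM r).
rewrite leqnn andbT; apply/subsetP=> _ /imsetP [s sS ->].
rewrite -FM addrC -(FD true 0 false s) addr0 /=.
by have := F_aut.2 false 0 s; rewrite /= F0 !subr0 => ->.
Qed.

(** The sum of the two image directions at [F i v] leads to a vertex whose preimage is a common
    neighbour of [v + a] and [v - a]. By the last hypothesis that preimage is [v], so the directions
    cancel. *)
Lemma straight_at i v a : rhombic S -> a \in S -> - a != a ->
  (forall y, y - a \in S -> y + a \in S -> y = 0) ->
  step i v (- a) = - step i v a.
Proof.
move=> rho aS aNa Ua; apply/eqP/negPn/negP => neq.
have [y Ey] := twofold_surj i (F i v + step i v a + step i v (- a)).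
have yv : y - v = 0.
  apply: Ua.
  - rewrite -addrA -opprD -(F_aut.2 (~~ i)) negbK Ey.
    rewrite (_ : _ - _ = step i v (- a)) ?step_mem ?S_sym //.
    by rewrite /step; ring.
  - rewrite (_ : y - v + a = y - (v + - a)); last by ring.
    rewrite -(F_aut.2 (~~ i)) negbK Ey.
    rewrite (_ : _ - _ = step i v a) ?step_mem //.
    by rewrite /step; ring.
move/eqP: neq; apply; move: Ey; rewrite -[y](subrK v) yv add0r => Ey.
by apply/eqP; rewrite -addr_eq0; apply/eqP/(addrI (F i v)); rewrite addr0 {2}Ey; ring.
Qed.

End TwofoldAut.

(** * Connection sets [{a, -a, b, -b}] in general position *)

(* Proves an equation that is the equation [E] up to ring identities and sign. *)
Ltac lin E :=
  match type of E with ?l = ?r =>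
    let E0 := fresh "E0" in
    have E0 : l - r = 0 := etrans (congr1 (fun x => x - r) E) (subrr r);
    apply: subr0_eq;
    first [ refine (etrans _ E0); ring
          | refine (etrans _ (etrans (congr1 -%R E0) (oppr0 _))); ring ]
  end.

Ltac absurd_lin E :=
  exfalso; match goal with H : _ <> _ |- _ => solve [apply: H; lin E] end.

(* The first equation would create twins, the other two additional common
   neighbours of [a] and [b]. *)
Definition generic_pair n (a b : 'Z_n) : Prop :=
  [/\ a + a <> b + b, b <> a + a + a & a <> b + b + b].

Lemma generic_pairC n (a b : 'Z_n) : generic_pair a b -> generic_pair b a.
Proof. by case=> h1 h2 h3; split=> // E; apply: h1. Qed.

Lemma generic_pairNN n (a b : 'Z_n) : generic_pair a b -> generic_pair (- a) (- b).
Proof. by case=> h1 h2 h3; split=> E; absurd_lin E. Qed.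

(** Comparing [z - p] and [z - q] gives sixteen equations; each puts [z] in [{0, p + q}] or
    contradicts [generic_pair]. *)
Lemma rhombic_pair n (S : {set 'Z_n}) p q z :
  (forall x, x \in S -> [\/ x = p, x = - p, x = q | x = - q]) -> generic_pair p q ->
  z - p \in S -> z - q \in S -> z = 0 \/ z = p + q.
Proof.
move=> HS [h1 h2 h3] /HS zp /HS; set r := z - q => zq.
have {zq} : [\/ r = p, r = - p, r = q | r = - q] by [].
have E : z - p + p = r + q by rewrite !subrK.
rewrite -[z in z = 0](subrK p) -[z in z = _ + _](subrK p).
case: zp E => -> E [] Er; rewrite Er in E;
  by [left; ring | right; ring | left; lin E | right; lin E | absurd_lin E].
Qed.

Section FourValent.
Variables (n : nat) (S : {set 'Z_n}) (a b : 'Z_n).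
Hypothesis SE : forall x, x \in S <-> [\/ x = a, x = - a, x = b | x = - b].

Lemma quad_sym s : (- s \in S) = (s \in S).
Proof.
suff H r : r \in S -> - r \in S by apply/idP/idP => /H //; rewrite opprK.
move/SE=> Hr; apply/SE.
by case: Hr => ->; rewrite ?opprK; [constructor 2 | constructor 1 | constructor 4 | constructor 3].
Qed.

(** Neighbours that are neither equal nor opposite are [a] and [b] up to order and signs, and
    [generic_pair] is available for each such choice. *)
Lemma quad_rhombic : generic_pair a b -> generic_pair a (- b) -> rhombic S.
Proof.
move=> sk skN p q z /SE pS /SE qS qp qNp zp zq.
have skl : generic_pair (- a) b by rewrite -[b]opprK; apply: generic_pairNN.
have sknn := generic_pairNN sk.
suff sk_pq : generic_pair p q.
  apply: rhombic_pair sk_pq zp zq => x /SE xS.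
  by case: pS qp qNp => ->; case: qS => ->; rewrite ?opprK ?eqxx // => _ _; move: xS;
    case=> ->; do ?[by constructor 1 | by constructor 2 | by constructor 3 | by constructor 4].
by case: pS qp qNp => ->; case: qS => ->; rewrite ?opprK ?eqxx // => _ _; apply: generic_pairC.
Qed.

(** Supplies the uniqueness that [straight_at] requires. *)
Lemma quad_unique_mid y : generic_pair a b -> generic_pair a (- b) ->
  a + a <> 0 -> a + a + a + a <> 0 -> y - a \in S -> y + a \in S -> y = 0.
Proof.
move=> [h1 h2 h3] [h4 h5 h6] h7 h8 /SE ya /SE.
have E : y - a + a + a = y + a by rewrite subrK.
rewrite -[y in y = 0](subrK a).
case: ya E => -> E [] Ey; rewrite Ey in E; by [ring | lin E | absurd_lin E].
Qed.

Lemma quad_straight F : twofold_aut S F -> generic_pair a b -> generic_pair a (- b) ->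
  a + a <> 0 -> a + a + a + a <> 0 -> a <> b -> a <> - b -> straight S F.
Proof.
move=> F_aut sk skN a2 a4 ab aNb i v.
have aS : a \in S by apply/SE; constructor 1.
have bS : b \in S by apply/SE; constructor 3.
have stra : step F i v (- a) = - step F i v a.
  apply: (straight_at quad_sym F_aut) => //; first exact: quad_rhombic.
    by apply/eqP=> E; apply: a2; lin E.
  by move=> y; apply: quad_unique_mid.
have inj := @step_inj _ _ _ F_aut i v.
have mem s : (step F i v s \in S) = (s \in S) := step_mem F_aut i v s.
(* One opposite pair of [S] is used up by the images of [a] and [- a], so [b] and [- b] go to the
   other. They share an image only when [- b = b], and then that image is its own negative. *)
suff strb : step F i v (- b) = - step F i v b.
  by move=> s /SE [] ->; rewrite ?opprK ?stra ?strb ?opprK.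
have uS : step F i v b \in S by rewrite mem.
have wS : step F i v (- b) \in S by rewrite mem quad_sym.
have pS : step F i v a \in S by rewrite mem.
have up : step F i v b <> step F i v a by move/inj => E; apply: ab.
have uNp : step F i v b <> - step F i v a by rewrite -stra => /inj E; apply: aNb; rewrite E opprK.
have wp : step F i v (- b) <> step F i v a by move/inj => E; apply: aNb.
have wNp : step F i v (- b) <> - step F i v a.
  by rewrite -stra => /inj /oppr_inj E; apply: ab.
have pNp : - step F i v a <> step F i v a.
  by rewrite -stra => /inj E; apply: a2; lin E.
have uw : step F i v (- b) = step F i v b -> - b = b by apply: inj.
move/SE: uS; move/SE: wS; move/SE: pS; move: up uNp wp wNp pNp uw {stra mem}.
move: (step F i v b) (step F i v (- b)) (step F i v a) => u w p up uNp wp wNp pNp uw.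
case=> Ep; rewrite {}Ep ?opprK in up uNp wp wNp pNp;
  case=> Ew //; rewrite {}Ew in wp wNp uw *;
  case=> Eu //; rewrite {}Eu ?opprK in up uNp uw * => //;
  by have E := uw erefl; rewrite ?opprK ?E //; case: pNp; rewrite ?opprK.
Qed.

End FourValent.

(** * Connection sets [{a, -a}] *)

(** Holds vacuously, as [q] can only be [p] or [- p]. *)
Lemma pair_rhombic n (S : {set 'Z_n}) a :
  (forall x, x \in S -> x = a \/ x = - a) -> rhombic S.
Proof.
by move=> SE p q z /SE pS /SE qS; case: pS => ->; case: qS => ->; rewrite ?opprK ?eqxx.
Qed.

Lemma pair_straight n (S : {set 'Z_n}) a F :
  (forall x, x \in S <-> x = a \/ x = - a) -> twofold_aut S F -> straight S F.
Proof.
move=> SE F_aut i v.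
have inj := @step_inj _ _ _ F_aut i v.
have aS : a \in S by apply/SE; left.
have NaS : - a \in S by apply/SE; right.
suff stra : step F i v (- a) = - step F i v a.
  by move=> s /SE [] ->; rewrite ?opprK ?stra ?opprK.
have := step_mem F_aut i v a; rewrite aS => /SE pS.
have := step_mem F_aut i v (- a); rewrite NaS => /SE qS.
have pq : step F i v (- a) = step F i v a -> - a = a by apply: inj.
move: pS qS pq; move: (step F i v a) (step F i v (- a)) => p q.
by case=> ->; case=> ->; rewrite ?opprK // => H; rewrite ?(H erefl).
Qed.

(** * Twins, cliques and the shape of a small connection set *)

(** The neighbourhood of 0 lies in that of [k], and equal valency makes the two vertices twins. *)
Lemma twin_free_shift n (S : {set 'Z_n}) d k :
  has_valency (cayley S) d -> twin_free (cayley S) ->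
  (forall s, s \in S -> s - k \in S) -> k = 0.
Proof.
move=> val tf Sk; apply/esym/tf/eqP; rewrite eqEcard !val leqnn andbT.
by apply/subsetP=> s; rewrite !inE /cayley subr0; apply: Sk.
Qed.

(** By connectivity X is complete, while [F true 0] is not adjacent to 0. This settles K_4 and
    K_5. *)
Lemma clique_shift0 n (S : {set 'Z_n}) F :
  connected_graph (cayley S) -> 0 \notin S -> twofold_aut S F -> F false 0 = 0 ->
  (forall s r, s \in S -> r \in S -> s + r = 0 \/ s + r \in S) -> F true 0 = 0.
Proof.
move=> conn S0 F_aut F0 SS.
have all_S x : x = 0 \/ x \in S.
  move: x; apply: cayley_connected_ind conn _ _ => [|x s sS]; first by left.
  by case=> [-> | xS]; [rewrite add0r; right | apply: SS].
have [// | tS] := all_S (F true 0).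
by have := twofold_shift_notin F_aut F0 S0; rewrite tS.
Qed.

(** In the second form [b] may be an involution, which covers the cubic case. A third class would
    give five elements, since Z_n has at most one involution. *)
Lemma symmetric_set_le4 n (S : {set 'Z_n}) :
  (1 < n)%N -> 0 \notin S -> (forall s, (- s \in S) = (s \in S)) ->
  S != set0 -> (#|S| <= 4)%N ->
  (exists a, forall x, x \in S <-> x = a \/ x = - a) \/
  (exists a b, [/\ a + a <> 0, a <> b, a <> - b &
     forall x, x \in S <-> [\/ x = a, x = - a, x = b | x = - b]]).
Proof.
move=> n_gt1 S0 S_sym /set0Pn [s0 s0S] S4.
have big (l : seq 'Z_n) : uniq l -> {subset l <= S} -> (size l <= 4)%N.
  move=> /card_uniqP <- lS; apply: leq_trans S4.
  by apply: subset_leq_card; apply/subsetP=> x /lS.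
have nz x : x \in S -> x != 0 by move=> xS; apply: contraNneq S0 => <-.
have big5 x y z : x \in S -> y \in S -> z \in S -> x + x != 0 -> y + y != 0 ->
    y != x -> y != - x -> z != x -> z != - x -> z != y -> z != - y -> False.
  move=> xS yS zS x2 y2 yx yNx zx zNx zy zNy.
  suff: (size [:: z; x; - x; y; - y]%R <= 4)%N by [].
  apply: big; last by apply/allP; rewrite /= zS !S_sym xS yS.
  have xNy : x != - y by rewrite -eqr_oppLR eq_sym.
  rewrite /= !inE !negb_or zx zNx zy zNy eqr_opp eqr_oppLR xNy (eq_sym x y) yx.
  by rewrite -!addr_eq0 x2 y2.
case: (pickP [pred a in S | a + a != 0]) => [a /andP [/= aS a2] | inv]; last first.
  left; exists s0 => x.
  have dbl y : y \in S -> y + y = 0.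
    by move=> yS; apply/eqP; have := inv y; rewrite /= yS => /negbFE.
  split=> [xS | [] ->]; rewrite ?S_sym //.
  by left; apply: Zp_involution_unique; rewrite ?dbl ?nz.
have NaS : - a \in S by rewrite S_sym.
case: (pickP [pred b in S | (b != a) && (b != - a)]) => [b /and3P [/= bS ba bNa] | none]; last first.
  left; exists a => x; split=> [xS | [] ->] //.
  have := none x; rewrite /= xS /= => /negbT; rewrite negb_and !negbK.
  by case/orP=> /eqP; [left | right].
have NbS : - b \in S by rewrite S_sym.
right; exists a, b; split.
- exact/eqP.
- by apply/eqP; rewrite eq_sym.
- by apply/eqP; rewrite eq_sym eqr_oppLR.
move=> x; split=> [xS | [] ->] //.
have [-> | xa] := eqVneq x a; first by constructor 1.
have [-> | xNa] := eqVneq x (- a); first by constructor 2.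
have [-> | xb] := eqVneq x b; first by constructor 3.
have [-> | xNb] := eqVneq x (- b); first by constructor 4.
(* At most one of [b] and [x] is an involution; the other serves as the second full pair in
   [big5]. *)
exfalso; have [b2 | b2] := eqVneq (b + b) 0; last exact: (big5 a b x).
apply: (big5 a x b) => //; rewrite 1?eq_sym //; last by rewrite eqr_oppLR.
by apply: contraNneq xb => x2; apply/eqP/Zp_involution_unique; rewrite ?nz.
Qed.

(** * The accidental case [b = 3a] *)

Ltac mem_lin SE E :=
  apply/SE; first [ constructor 1; solve [ring | lin E]
                  | constructor 2; solve [ring | lin E]
                  | constructor 3; solve [ring | lin E]
                  | constructor 4; solve [ring | lin E] ].

Ltac clique_lin SE E :=
  move=> s r /SE [] -> /SE [] ->;
  solve [left; ring | left; lin E | right; mem_lin SE E].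

Section Triple.
Variables (n : nat) (n_gt1 : (1 < n)%N) (S : {set 'Z_n}) (a : 'Z_n).
Hypothesis SE :
  forall x, x \in S <-> [\/ x = a, x = - a, x = a + a + a | x = - (a + a + a)].

(** For even [n] all of [S] has the parity of [a]. If that is odd, parity is a 2-colouring; if even,
    1 cannot be reached from 0. *)
Lemma triple_odd : connected_graph (cayley S) -> ~ bipartite (cayley S) -> odd n.
Proof.
move=> conn nbip; apply/negPn/negP => n_even; apply: nbip.
have oddD (x y : 'Z_n) := odd_Zp_add n_gt1 x y n_even.
have oddN (x : 'Z_n) : odd (- x)%R = odd x.
  by have := oddD x (- x); rewrite subrr /=; case: (odd x); case: odd.
have oddS (s : 'Z_n) : s \in S -> odd s = odd a.
  by move=> /SE [] ->; rewrite ?oddN ?oddD; case: (odd a).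
case a_odd: (odd a).
  exists (fun v : 'Z_n => odd v) => v w /oddS; rewrite oddD oddN a_odd.
  by case: (odd v); case: (odd w).
have all_even (x : 'Z_n) : odd x = false.
  move: x; apply: cayley_connected_ind conn _ _ => // x s sS x_even.
  by rewrite oddD x_even oddS.
have := all_even 1; rewrite -[1]/(1%:R) val_Zp_nat //.
by rewrite modn_small.
Qed.

Lemma triple_shift0 d F : connected_graph (cayley S) -> ~ bipartite (cayley S) ->
  twin_free (cayley S) -> has_valency (cayley S) d -> 0 \notin S ->
  twofold_aut S F -> F false 0 = 0 -> F true 0 = 0.
Proof.
move=> conn nbip tf val S0 F_aut F0.
have n_odd := triple_odd conn nbip.
(* When [5a = 0], the set [S] consists of the nonzero multiples of [a], and X is K_5. *)
have [a5 | /eqP a5] := eqVneq (a + a + a + a + a) 0.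
  by apply: clique_shift0 F_aut F0 _ => //; clique_lin SE a5.
have half (x : 'Z_n) : x + x = 0 -> x = 0.
  move=> x2; apply/eqP/negPn/negP => x0.
  by have [] := Zp_involution n_gt1 x2 x0; rewrite n_odd.
have aS : a \in S by apply/SE; constructor 1.
have bS : a + a + a \in S by apply/SE; constructor 3.
have NaS : - a \in S by apply/SE; constructor 2.
have a1 : a <> 0 by move=> a0; move: S0; rewrite -a0 aS.
have a3 : a + a + a <> 0 by move=> a0; move: S0; rewrite -a0 bS.
(* Doubling is injective for odd [n], so these multiples inherit nonvanishing from [a], [3a] and
   [5a]; they refute the coincidences met below. *)
have a2 : a + a <> 0 by move/half.
have a4 : a *+ 4 <> 0 by move=> E; apply/a2/half; lin E.
have a6 : a *+ 6 <> 0 by move=> E; apply/a3/half; lin E.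
have a8 : a *+ 8 <> 0 by move=> E; apply/a4/half; lin E.
have a10 : a *+ 10 <> 0 by move=> E; apply/a5/half; lin E.
have a12 : a *+ 12 <> 0 by move=> E; apply/a6/half; lin E.
(* An opposite pair of common neighbours of 0 and [z] is either [a], [- a], which forces [z] to be
   [2a] or [-2a], or [3a], [-3a], which leaves only [z = 0]. *)
have across z : z - a \in S -> z + a \in S -> z <> 0 -> z = a + a \/ z = - (a + a).
  move=> /SE za; have Ez := subrK a z.
  case: za => Er; rewrite {}Er in Ez; rewrite -{z}Ez => /SE [] E z0;
    solve [left; ring | right; ring | left; lin E | right; lin E
          | case: z0; ring | case: z0; lin E | absurd_lin E].
have far z : z - (a + a + a) \in S -> z + (a + a + a) \in S -> z = 0.
  move=> /SE za; have Ez := subrK (a + a + a) z.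
  case: za => Er; rewrite {}Er in Ez; rewrite -{z}Ez => /SE [] E;
    solve [ring | lin E | absurd_lin E].
(* Vertices of one layer differ by [2a] or [-2a] iff they have three common
   neighbours, and among three elements of [S] two are opposite. *)
have dir x : F false (x + (a + a)) - F false x = a + a \/
             F false (x + (a + a)) - F false x = - (a + a).
  set z := F false _ - _.
  have z0 : z <> 0.
    move=> /subr0_eq /(F_aut.1 false) E; apply: a2.
    by apply: (addrI x); rewrite addr0.
  have zS s : (z - step F false x s \in S) = (a + a - s \in S).
    rewrite (_ : z - _ = F (~~ true) (x + (a + a)) - F true (x + s)).
      by rewrite F_aut.2; congr (_ \in S); ring.
    by rewrite /z /step /=; ring.
  have z1 : z - step F false x a \in S by rewrite zS; apply/SE; constructor 1; ring.
  have z2 : z - step F false x (- a) \in S by rewrite zS; apply/SE; constructor 3; ring.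
  have z3 : z - step F false x (a + a + a) \in S by rewrite zS; apply/SE; constructor 2; ring.
  have inj := @step_inj _ _ _ F_aut false x.
  have p12 : step F false x a <> step F false x (- a).
    by move=> /inj E; apply: a2; lin E.
  have p13 : step F false x a <> step F false x (a + a + a).
    by move=> /inj E; apply: a2; lin E.
  have p23 : step F false x (- a) <> step F false x (a + a + a).
    by move=> /inj E; apply: a4; lin E.
  have := step_mem F_aut false x a; rewrite aS => /SE.
  have := step_mem F_aut false x (- a); rewrite NaS => /SE.
  have := step_mem F_aut false x (a + a + a); rewrite bS => /SE.
  move: z z0 z1 z2 z3 p12 p13 p23 {zS inj}.
  move: (step F false x a) (step F false x (- a)) (step F false x (a + a + a)).
  move=> p1 p2 p3 z z0 z1 z2 z3 p12 p13 p23.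
  case=> E3; rewrite {}E3 ?opprK in z3 p13 p23;
  case=> E2; rewrite {}E2 ?opprK in z2 p12 p23 => //;
  case=> E1; rewrite {}E1 ?opprK in z1 p12 p13 => //;
  first [exact: across | by case: z0; apply: far].
have [e Fe] : exists e : bool, forall k, F false ((a + a) *+ k) = ((-1) ^+ e * (a + a)) *+ k.
  have [e Ee] : exists e : bool, F false (a + a) = (-1) ^+ e * (a + a).
    have := dir 0; rewrite F0 subr0 add0r.
    by case=> ->; [exists false; rewrite expr0 mul1r | exists true; rewrite expr1 mulN1r].
  exists e; suff Hk k : F false ((a + a) *+ k) = ((-1) ^+ e * (a + a)) *+ k /\
                        F false ((a + a) *+ k.+1) = ((-1) ^+ e * (a + a)) *+ k.+1.
    by move=> k; case: (Hk k).
  elim: k => [|k [IH1 IH2]]; first by rewrite !mulr0n !mulr1n F0 Ee.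
  split=> //; move: IH1 IH2; rewrite !mulrSr; move: ((a + a) *+ k) => y.
  move=> <-; set c := _ * (a + a) => E1; rewrite -E1.
  have [E | E] : F false (y + (a + a) + (a + a)) - F false (y + (a + a)) = c \/
                 F false (y + (a + a) + (a + a)) - F false (y + (a + a)) = - c.
  - rewrite /c; case: (dir (y + (a + a))) => ->; case: (e);
      rewrite ?expr0 ?expr1 ?mul1r ?mulN1r ?opprK; by [left | right].
  - by lin E.
  (* A reversal of the sign would give [y] and [y + a *+ 4] the same image. *)
  - case: a4; apply: (addrI y); rewrite addr0; apply: (F_aut.1 false).
    rewrite (_ : y + a *+ 4 = y + (a + a) + (a + a)); last by ring.
    by rewrite E1 in E; lin E.
(* For odd [n], [(n.+1)./2] inverts 2, so every multiple of [a] is a multiple of [2a]. *)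
have Fm j : F false (a *+ j) = (-1) ^+ e * (a *+ j).
  have n0 : n%:R = 0 :> 'Z_n := pchar_Zp n_gt1.
  have Ej : (a + a) *+ ((n.+1)./2 * j) = a *+ j.
    rewrite -mulr2n -mulrnA mulnA mul2n.
    have -> : (n.+1)./2.*2 = n.+1 by rewrite -[RHS]odd_double_half /= n_odd.
    by rewrite mulSn mulrnDr -[in a *+ (n * j)]mulr_natr natrM n0 mul0r mulr0 addr0.
  by rewrite -{1}Ej Fe -mulrnAr Ej.
have FS s : s \in S -> F false s = (-1) ^+ e * s.
  have nat_mul (c : 'Z_n) : a * c = a *+ c by rewrite -mulr_natr natr_Zp.
  have Fc c : F false (a * c) = (-1) ^+ e * (a * c) by rewrite nat_mul Fm.
  move=> /SE [] ->.
  - by rewrite -(Fm 1%N).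
  - by rewrite (_ : - a = a * - 1) ?Fc //; ring.
  - by rewrite (_ : a + a + a = a * 3%:R) ?Fc //; ring.
  - by rewrite (_ : - (a + a + a) = a * - 3%:R) ?Fc //; ring.
(* Since [F false] acts on [S] as a sign, the edges at vertex 0 of the other layer show that
   subtracting [F true 0] maps [S] into itself. *)
apply: (twin_free_shift val tf) => s sS.
have eS : (-1) ^+ e * s \in S.
  by case: (e); rewrite ?expr0 ?expr1 ?mul1r ?mulN1r ?(quad_sym SE).
have Es : s = F false ((-1) ^+ e * s).
  by rewrite FS // mulrA -signr_addb addbb mul1r.
by rewrite Es (F_aut.2 true) subr0.
Qed.

End Triple.

(** * Combination of the cases *)

(** Subtracting [a - b] swaps [a] with [b] and [- a] with [- b]. *)
Lemma quad_twin_free n (S : {set 'Z_n}) a b d :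
  (forall x, x \in S <-> [\/ x = a, x = - a, x = b | x = - b]) ->
  has_valency (cayley S) d -> twin_free (cayley S) -> a + a = b + b -> a = b.
Proof.
move=> SE val tf E; apply: subr0_eq; apply: (twin_free_shift val tf) => s.
by move=> /SE [] ->; mem_lin SE E.
Qed.

Lemma quadN n (S : {set 'Z_n}) a b :
  (forall x, x \in S <-> [\/ x = a, x = - a, x = b | x = - b]) ->
  forall x, x \in S <-> [\/ x = a, x = - a, x = - b | x = - - b].
Proof.
move=> SE x; rewrite opprK SE; split=> -[] ->;
  by [constructor 1 | constructor 2 | constructor 3 | constructor 4].
Qed.

Lemma quadC n (S : {set 'Z_n}) a b :
  (forall x, x \in S <-> [\/ x = a, x = - a, x = b | x = - b]) ->
  forall x, x \in S <-> [\/ x = b, x = - b, x = a | x = - a].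
Proof.
move=> SE x; rewrite SE; split=> -[] ->;
  by [constructor 1 | constructor 2 | constructor 3 | constructor 4].
Qed.

Theorem theorem4p1 (n : nat) (n_gt1 : (1 < n)%N) (S : {set 'Z_n})
    (S_no0 : 0 \notin S) (S_sym : [set - s | s in S] = S)
    (d : nat) (d_val : has_valency (cayley S) d) (d_le4 : (d <= 4)%N)
    (S_unst : nontrivially_unstable (cayley S)) :
  wilson_C4 S.
Proof.
have [conn nbip tf unst] := S_unst.
have symS s : (- s \in S) = (s \in S).
  by rewrite -{1}S_sym mem_imset //; apply: oppr_inj.
have conn2 : connected_graph (double_cover (cayley S)).
  by apply: double_cover_connected => // u v; rewrite /cayley -symS opprB.
have [F [F_aut F0 t0]] := unstable_twofold conn2 unst.
have C4 := affine_wilson_C4 F_aut n_gt1 conn2.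
have S_card : (#|S| <= 4)%N.
  rewrite -(_ : nbhd (cayley S) 0 = S) ?d_val //.
  by apply/setP=> x; rewrite inE /cayley subr0.
have S_nonempty : S != set0.
  apply/negP=> /eqP SE.
  have all0 (x : 'Z_n) : x = 0.
    by move: x; apply: (cayley_connected_ind conn) => // x s; rewrite SE inE.
  by have := oner_neq0 'Z_n; rewrite (all0 1) eqxx.
case: (symmetric_set_le4 n_gt1 S_no0 symS S_nonempty S_card) => [[a SE] | [a [b [a2 ab aNb SE]]]].
  by apply: C4 => //; [apply: pair_straight SE F_aut | apply: (@pair_rhombic _ _ a) => x /SE].
have SEN := quadN SE; have SEC := quadC SE; have SECN := quadN SEC.
have no_triple x y : (forall z, z \in S <-> [\/ z = x, z = - x, z = y | z = - y]) ->
    y <> x + x + x.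
  move=> SExy Exy; rewrite Exy in SExy; move/eqP: t0; apply.
  exact: (triple_shift0 n_gt1 SExy conn nbip tf d_val S_no0 F_aut F0).
have sk : generic_pair a b.
  split; [| exact: no_triple SE | exact: no_triple SEC].
  by move/(quad_twin_free SE d_val tf).
have skN : generic_pair a (- b).
  split; [| exact: no_triple SEN |].
  - by move/(quad_twin_free SEN d_val tf).
  - move=> E; apply: (no_triple _ _ SECN); lin E.
(* [quad_straight] needs one generator whose fourfold is nonzero; [a] and [b] exchange roles if only
   [b] qualifies. *)
have [a4 | /eqP a4] := eqVneq (a + a + a + a) 0; last first.
  by apply: C4 => //; [apply: (quad_straight SE) | apply: (quad_rhombic SE)].
have [b4 | /eqP b4] := eqVneq (b + b + b + b) 0; last first.
  have skC := generic_pairC sk.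
  have skCN : generic_pair b (- a) by apply/generic_pairC; rewrite -[b]opprK; apply: generic_pairNN.
  apply: C4 => //; [apply: (quad_straight SEC) => // | exact: (quad_rhombic SEC)].
  - by move=> b2; apply: b4; rewrite b2 add0r.
  - by move=> E; apply: ab.
  - by move=> E; apply: aNb; rewrite E opprK.
(* Now [2a] is the involution. If [2b] is nonzero it equals [2a], which [sk] excludes; otherwise
   [b = 2a] and X is K_4. *)
have [b2 | b2] := eqVneq (b + b) 0; last first.
  case: sk => /(_ _) [] //; apply: (Zp_involution_unique n_gt1) => //; rewrite ?addrA //.
  exact/eqP.
have b0 : b != 0 by apply: contraNneq S_no0 => <-; apply/SE; constructor 3.
have Eb : b = a + a.
  by apply: (Zp_involution_unique n_gt1) => //; rewrite ?addrA //; apply/eqP.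
rewrite Eb in SE; move/eqP: t0; case.
by apply: clique_shift0 F_aut F0 _ => //; clique_lin SE a4.
Qed.
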